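(* Let $(X,d)$ be a minimally nice metric space with quasihyperbolic metric $k$. Then $X$ is quasihyperbolic $a$-John (for a constant $a\ge 1$) if and only if there is a constant $A>0$ such that for each quasihyperbolic geodesic $[x,y]_k$ with endpoints $x,y\in X$ satisfying $d(u)\le 2\min\{d(x),d(y)\}$ for all $u\in[x,y]_k$, we have $k(x,y)\le A$. The constants $a$ and $A$ depend only on each other; that is, if $X$ is quasihyperbolic $a$-John then the condition holds with some $A$ depending only on $a$, and if the condition holds with constant $A$ then $X$ is quasihyperbolic $a$-John with some $a$ depending only on $A$.
   Context: A metric space $(X,d)$ is minimally nice if it is locally compact, incomplete and rectifiably connected (every pair of points can be joined by a curve of finite length) and the identity map $(X,d)\to(X,l)$ is continuous, where $l(x,y)$ is the infimum of the $d$-lengths $\ell(\gamma)$ of rectifiable curves $\gamma$ in $X$ joining $x$ and $y$. The metric boundary is $\partial X=\bar X\setminus X$, where $\bar X$ is the metric completion, and $d(z)=\mathrm{dist}(z,\partial X)$ for $z\in X$. The quasihyperbolic metric is $k(x,y)=\inf_\gamma\int_\gamma \frac{ds}{d(z)}$, the infimum over all rectifiable curves $\gamma$ in $X$ with endpoints $x,y$, with $ds$ the arc-length element with respect to $d$; a quasihyperbolic geodesic $[x,y]_k$ is a geodesic of $(X,k)$ with endpoints $x,y$. For $a\ge1$, an arc $\alpha$ with endpoints $x,y$ is a double $a$-cone arc if $\min\{\ell(\alpha[x,z]),\ell(\alpha[z,y])\}\le a\,d(z)$ for all $z\in\alpha$, where $\alpha[x,z]$ and $\alpha[z,y]$ are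 the subarcs of $\alpha$ between the indicated points and $\ell$ is $d$-length. $X$ is quasihyperbolic $a$-John if every quasihyperbolic geodesic in $X$ is a double $a$-cone arc. *)

(* Defs.v *)
From HB Require Import structures.
From mathcomp Require Import all_boot all_order all_algebra.
From mathcomp Require Import all_classical all_reals all_analysis.

Set Implicit Arguments.
Unset Strict Implicit.
Unset Printing Implicit Defensive.

Import Order.TTheory GRing.Theory Num.Theory.
Import numFieldNormedType.Exports.

Local Open Scope classical_set_scope.
Local Open Scope ring_scope.

(* The completeness axiom of the library's [completeType], as a predicate, so
   that it can be negated; [exists l] replaces [cvg F], which needs a pointed
   type. *)
Definition metric_complete (R : realType) (M : metricType R) : Prop :=
  forall F : set_system M, ProperFilter F -> cauchy F -> exists l : M, F --> l.

(* The metric completion is given by its universal description, which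
   determines it up to an isometry that fixes [X]. *)
Record metric_completion (R : realType) (X : metricType R) := MetricCompletion {
  cpl_space : metricType R;
  cpl_emb : X -> cpl_space;
  cpl_isometry : forall x y : X, mdist (cpl_emb x) (cpl_emb y) = mdist x y;
  cpl_dense : dense (range cpl_emb);
  cpl_complete : metric_complete cpl_space }.

Section curves.
Context {R : realType} {X : metricType R}.
Implicit Types (x y : X) (a b : R) (g : R -> X).

(* [numfun.variation] for maps into a metric space *)
Definition metric_variation a b g (s : seq R) : R :=
  let F := g \o nth b (a :: s) in
  \sum_(0 <= n < size s) mdist (F n) (F n.+1).

Definition curve_length a b g : \bar R :=
  ereal_sup [set (metric_variation a b g s)%:E | s in itv_partition a b].

(* A curve is a map on a compact interval [[a, b]]; the values of [g : R -> X]
   outside of it are irrelevant. *)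
Definition curve x y a b g : Prop :=
  [/\ a <= b, {within `[a, b], continuous g}, g a = x & g b = y].

Definition rectifiable_curve x y a b g : Prop :=
  curve x y a b g /\ (curve_length a b g < +oo)%E.

Definition arc x y a b g : Prop :=
  curve x y a b g /\ {in `[a, b] &, injective g}.

(* The point of the curve at arc length [t] from its origin: [g] is constant on
   the set of parameters in question, and the infimum is attained when [g] is a
   rectifiable curve and [t] is at most its length. *)
Definition arc_length_param a b g (t : R) : X :=
  g (inf [set u | u \in `[a, b] /\ curve_length a u g = t%:E]).

Definition line_integral (rho : X -> R) a b g : \bar R :=
  (\int[lebesgue_measure]_(t in `[0%R, fine (curve_length a b g)])
    (rho (arc_length_param a b g t))%:E)%E.

Definition inner_length x y : \bar R :=
  ereal_inf [set L | exists a b g,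
    rectifiable_curve x y a b g /\ L = curve_length a b g].

End curves.

Definition minimally_nice (R : realType) (X : metricType R) : Prop :=
  [/\ locally_compact [set: X],
      ~ metric_complete X,
      (forall x y : X, exists a b g, rectifiable_curve x y a b g) &
      (* continuity of the identity from the metric to the inner length *)
      (forall (x : X) (e : R), 0 < e ->
         \forall y \near x, (inner_length x y < e%:E)%E)].

Section quasihyperbolic.
Context {R : realType} {X : metricType R} (cX : metric_completion X).
Implicit Types (x y : X) (a b u v L : R) (g : R -> X).

Definition metric_boundary : set (cpl_space cX) := ~` range (cpl_emb cX).

Definition bdist (z : X) : R :=
  inf [set mdist (cpl_emb cX z) w | w in metric_boundary].

(* Extended-real valued, so that no convention is needed for infinite values *)
Definition qhdist x y : \bar R :=
  ereal_inf [set I | exists a b g,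
    rectifiable_curve x y a b g /\
    I = line_integral (fun z => (bdist z)^-1) a b g].

(* An isometric embedding of [[0, L]] into [X] with the metric [qhdist];
   the constant geodesics ([L = 0]) are included. *)
Definition qh_geodesic x y L g : Prop :=
  [/\ 0 <= L, g 0 = x, g L = y &
      {in `[0, L] &, forall s t, qhdist (g s) (g t) = `|s - t|%:E}].

Definition double_cone_arc (c : R) x y u v g : Prop :=
  arc x y u v g /\
  {in `[u, v], forall t, (Order.min (curve_length u t g) (curve_length t v g)
                          <= (c * bdist (g t))%:E)%E}.

Definition qh_John (c : R) : Prop :=
  forall x y L g, qh_geodesic x y L g -> double_cone_arc c x y 0 L g.

Definition qh_bounded_geodesics (A : R) : Prop :=
  forall x y L g, qh_geodesic x y L g ->
    {in `[0, L], forall t, bdist (g t) <= 2 * Num.min (bdist x) (bdist y)} ->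
    (qhdist x y <= A%:E)%E.

End quasihyperbolic.

(* Main.v *)
(* Under the bounded-geodesics condition, put f = d(.) along a geodesic
   parametrized by quasihyperbolic length, and let t <= t0 with f maximal at t0.
   Between the first time s at which f reaches M / 2 and the first time after t
   at which f reaches M, where M = max f on [0, t], one has
   f <= M <= 2 min of the endpoint values, so this piece has quasihyperbolic
   length at most A and length at most 2AM.  Repeating with M / 2 on [0, s]
   gives a geometric series: the length of the geodesic up to t is at most 4AM,
   and M is comparable to f t by a Harnack inequality.
   Conversely, if a geodesic with f <= 2r, r = min(d(x), d(y)), is a double cone
   arc, its length is at most a multiple of ar and f >= r / (2a) on it, so its
   quasihyperbolic length is at most a multiple of a ^ 2. *)

Require Import Defs.
From mathcomp Require Import all_boot all_order all_algebra.
From mathcomp Require Import all_classical all_reals all_analysis.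
From mathcomp Require Import lra ring.
Set Implicit Arguments.
Unset Strict Implicit.
Unset Printing Implicit Defensive.
Import Order.TTheory GRing.Theory Num.Theory.
Import numFieldNormedType.Exports.
Import metricType_numDomainType.
Local Open Scope classical_set_scope.
Local Open Scope ring_scope.

(** * Length of curves in a metric space: additivity, reversal, Lipschitz bounds *)

Section metric_length.
Context {R : realType} {X : metricType R}.
Implicit Types (a b c u v : R) (g : R -> X) (s : seq R).

Lemma metric_variation_nil a b g : metric_variation a b g [::] = 0.
Proof. by rewrite /metric_variation big_geq. Qed.

Lemma metric_variation_cons a b g x s :
  metric_variation a b g (x :: s) =
  mdist (g a) (g x) + metric_variation x b g s.
Proof. by rewrite /metric_variation big_nat_recl. Qed.

Lemma metric_variation_cat a b c g s t : itv_partition a b s ->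
  metric_variation a c g (s ++ t) =
  metric_variation a b g s + metric_variation b c g t.
Proof.
elim: s a => [a /itv_partition_nil ->|x s IH a abs] /=.
  by rewrite metric_variation_nil add0r.
by rewrite !metric_variation_cons (IH _ (itv_partition_cons abs)) addrA.
Qed.

Lemma itv_partition_cons_lt a b x s : itv_partition a b (x :: s) ->
  [/\ a < x, x <= b & itv_partition x b s].
Proof.
move=> abs; have xbs := itv_partition_cons abs.
split => //; last exact: itv_partition_le xbs.
by case: abs => /= /andP[].
Qed.

Lemma metric_variation_le_length a b g s : itv_partition a b s ->
  ((metric_variation a b g s)%:E <= curve_length a b g)%E.
Proof. by move=> abs; apply: ereal_sup_ubound; exists s. Qed.

Lemma curve_length_le a b g M :
  (forall s, itv_partition a b s -> ((metric_variation a b g s)%:E <= M)%E) ->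
  (curve_length a b g <= M)%E.
Proof. by move=> H; apply: ge_ereal_sup => _ [s abs <-]; exact: H. Qed.

Lemma mdist_le_length a b g : a <= b ->
  ((mdist (g a) (g b))%:E <= curve_length a b g)%E.
Proof.
rewrite le_eqVlt => /predU1P[<-|ab].
  rewrite mdistxx -(metric_variation_nil a a g).
  by apply: metric_variation_le_length; split.
have := metric_variation_le_length g (itv_partition1 ab).
by rewrite metric_variation_cons metric_variation_nil addr0.
Qed.

Lemma curve_length_ge0 a b g : a <= b -> (0 <= curve_length a b g)%E.
Proof. by move/(mdist_le_length g); apply: le_trans; rewrite lee_fin mdist_ge0. Qed.

Lemma curve_lengthxx a g : curve_length a a g = 0%E.
Proof.
apply/eqP; rewrite eq_le curve_length_ge0// andbT.
by apply: curve_length_le => s /itv_partitionxx ->; rewrite metric_variation_nil.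
Qed.

(** Partitions of the two pieces concatenate to one of the whole. The suprema are taken one at a
    time by moving the other term across the inequality, which requires that term to be finite. *)
Lemma curve_length_superadd a b c g : a <= b -> b <= c ->
  (curve_length a b g + curve_length b c g <= curve_length a c g)%E.
Proof.
move=> ab bc.
have vle s t : itv_partition a b s -> itv_partition b c t ->
    ((metric_variation a b g s)%:E + (metric_variation b c g t)%:E
       <= curve_length a c g)%E.
  move=> abs bct; rewrite -EFinD -metric_variation_cat//.
  exact/metric_variation_le_length/(itv_partition_cat abs).
have sle s : itv_partition a b s ->
    ((metric_variation a b g s)%:E + curve_length b c g
       <= curve_length a c g)%E.
  move=> abs; rewrite -leeBrDl//; apply: curve_length_le => t bct.
  by rewrite leeBrDl//; exact: vle.
have [fin|] := boolP (curve_length b c g \is a fin_num).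
  rewrite -leeBrDr//; apply: curve_length_le => s abs.
  by rewrite leeBrDr//; exact: sle.
rewrite ge0_fin_numE ?curve_length_ge0// -leNgt leye_eq => /eqP bcy.
(* If the second piece has infinite length, a single partition of [[a, b]] (empty when [a = b])
   already forces the whole length to be infinite. *)
suff -> : curve_length a c g = +oo%E by rewrite leey.
have [s abs] : exists s, itv_partition a b s.
  move: ab; rewrite le_eqVlt => /predU1P[<-|ab]; first by exists [::].
  by exists [:: b]; exact: itv_partition1.
by apply/eqP; rewrite -leye_eq; have := sle _ abs; rewrite bcy addey.
Qed.

(** Inserting [b] into a partition of [[a, c]] does not decrease its variation. The induction peels
    off partition points up to [b]; the first step that jumps past [b] is split there by the
    triangle inequality. *)
Lemma curve_length_subadd a b c g : a <= b -> b <= c ->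
  (curve_length a c g <= curve_length a b g + curve_length b c g)%E.
Proof.
move=> ab bc; apply: curve_length_le => s; elim: s a ab => [|x s IH] a ab acs.
  by rewrite metric_variation_nil adde_ge0// curve_length_ge0.
rewrite metric_variation_cons EFinD.
have [ax xc xcs] := itv_partition_cons_lt acs.
have [xb|bx] := leP x b.
  apply: (@le_trans _ _ ((mdist (g a) (g x))%:E +
      (curve_length x b g + curve_length b c g))%E).
    by rewrite leeD2l// IH.
  rewrite addeA leeD2r//; apply: le_trans (curve_length_superadd _ (ltW ax) xb).
  by rewrite leeD2r// mdist_le_length// ltW.
apply: (@le_trans _ _ ((mdist (g a) (g b))%:E +
    ((mdist (g b) (g x))%:E + (metric_variation x c g s)%:E))%E).
  by rewrite addeA leeD2r// -EFinD lee_fin metric_triangle.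
apply: leeD; first exact: mdist_le_length.
rewrite -EFinD -metric_variation_cons; apply: metric_variation_le_length.
by case: acs => /= /andP[_ xs] xsc; split; rewrite //= bx.
Qed.

Lemma curve_length_cat a b c g : a <= b -> b <= c ->
  curve_length a c g = (curve_length a b g + curve_length b c g)%E.
Proof.
move=> ab bc; apply/eqP.
by rewrite eq_le curve_length_subadd//= curve_length_superadd.
Qed.

Lemma curve_length_sub a b u v g : a <= u -> u <= v -> v <= b ->
  (curve_length u v g <= curve_length a b g)%E.
Proof.
move=> au uv vb; rewrite (@curve_length_cat a u b)//; last exact: le_trans vb.
rewrite (@curve_length_cat u v b)// addeCA leeDl// adde_ge0// curve_length_ge0//.
Qed.

(** Reversed partitions have the same variation. One inequality suffices, since [t |-> c - t] is an
    involution. *)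
Lemma curve_length_rev_le a b c g :
  (curve_length a b g <= curve_length (c - b) (c - a) (fun t => g (c - t)%R))%E.
Proof.
apply: curve_length_le => s abs.
suff [t bat ->] : exists2 t, itv_partition (c - b) (c - a) t &
    metric_variation a b g s =
    metric_variation (c - b) (c - a) (fun t => g (c - t)) t.
  exact: metric_variation_le_length.
elim: s a abs => [a /itv_partition_nil ->|x s IH a abs].
  by exists [::]; rewrite ?metric_variation_nil//; split.
have [ax xb /IH[t bxt Et]] := itv_partition_cons_lt abs.
have xa : itv_partition (c - x) (c - a) [:: c - a].
  by apply: itv_partition1; rewrite ltrD2l ltrN2.
exists (t ++ [:: c - a]); first exact: itv_partition_cat xa.
rewrite (metric_variation_cat _ _ _ bxt) !metric_variation_cons.
by rewrite metric_variation_nil !subKr addr0 Et addrC metric_sym.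
Qed.

Lemma curve_length_rev a b c g :
  curve_length (c - b) (c - a) (fun t => g (c - t)) = curve_length a b g.
Proof.
apply/eqP; rewrite eq_le curve_length_rev_le andbT.
apply: le_trans (curve_length_rev_le _ _ c _) _; rewrite !subKr.
by rewrite (_ : (fun t => g (c - (c - t))) = g)//; apply/funext => t; rewrite subKr.
Qed.

(** A Lipschitz bound at scale [h] bounds the length of pieces no longer than [h], and additivity of
    length sums these bounds. The local form matters because the estimate for quasihyperbolic
    geodesics holds only at small scales. *)
Lemma curve_length_lipschitz a b g (C h : R) : 0 < h -> a <= b ->
  (forall u v, a <= u -> u <= v -> v <= b -> v - u <= h ->
     mdist (g u) (g v) <= C * (v - u)) ->
  (curve_length a b g <= (C * (b - a))%:E)%E.
Proof.
move=> h0 ab Hg.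
have short u v : a <= u -> u <= v -> v <= b -> v - u <= h ->
    (curve_length u v g <= (C * (v - u))%:E)%E.
  move=> au uv vb uvh; apply: curve_length_le => s; rewrite lee_fin.
  elim: s u au uv uvh => [u _ _ _ /itv_partition_nil ->|x s IH u au uv uvh uvs].
    by rewrite metric_variation_nil subrr mulr0.
  have [ux xv xvs] := itv_partition_cons_lt uvs.
  rewrite metric_variation_cons.
  have -> : C * (v - u) = C * (x - u) + C * (v - x) by ring.
  by apply: lerD; [apply: Hg|apply: IH] => //; lra.
(* Induction on a number [n] of steps of size [h] that suffices to reach [v]. *)
suff H n : forall v, a <= v -> v <= b -> v - a <= n%:R * h ->
    (curve_length a v g <= (C * (v - a))%:E)%E.
  apply: (H (Num.truncn ((b - a) / h)).+1) => //.
  by rewrite -ler_pdivrMr// ltW// truncnS_gt.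
elim: n => [|n IH] v av vb; rewrite ?mul0r.
  move=> va; have -> : v = a by apply/eqP; rewrite eq_le av andbT -subr_le0.
  by rewrite curve_lengthxx subrr mulr0.
rewrite -natr1 mulrDl mul1r => vn.
have [vh|vh] := leP (v - a) h; first exact: short.
rewrite (@curve_length_cat a (v - h) v); [|lra|lra].
have -> : C * (v - a) = C * (v - h - a) + C * (v - (v - h)) by ring.
by rewrite EFinD; apply: leeD; [apply: IH|apply: short]; lra.
Qed.

End metric_length.

(** * Semicontinuity of length and the intermediate value property of arc length *)

Section arc_length.
Context {R : realType} {X : metricType R}.
Implicit Types (a b c u v : R) (g : R -> X).

Lemma within_itv_continuousP (Y : metricType R) a b (f : R -> Y) :
  {within `[a, b], continuous f} <->
  forall u, a <= u <= b -> forall e, 0 < e -> exists2 h, 0 < h &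
    forall v, a <= v <= b -> `|u - v| < h -> mdist (f u) (f v) < e.
Proof.
split=> [/subspace_continuousP cf u uab e e0|cf].
  have /cf/cvgrPdist_lt/(_ _ e0) : [set` `[a, b]] u by rewrite /= in_itv.
  rewrite near_withinE => -[h h0 Hh]; exists h => // v vab uv.
  by apply: Hh => //=; rewrite in_itv.
apply/subspace_continuousP => u; rewrite /= in_itv /= => uab.
apply/cvgrPdist_lt => e e0; rewrite near_withinE.
have [h h0 Hh] := cf _ uab _ e0.
by exists h => // v uv; rewrite /= in_itv => vab; apply: Hh.
Qed.

(** A partition whose variation exceeds [V] has some margin to spare; moving its first point from
    [a] to a nearby [u] loses at most [mdist (g a) (g u)], which continuity makes smaller than the
    margin. *)
Lemma curve_length_lsc_right a b g (V : R) : a < b ->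
  {within `[a, b], continuous g} -> (V%:E < curve_length a b g)%E ->
  exists2 s, a < s <= b &
    forall u, a <= u <= s -> (V%:E < curve_length u b g)%E.
Proof.
move=> ab /within_itv_continuousP cg /ereal_sup_gt[_ [[|x p] abp <-]].
  by move: ab; rewrite (itv_partition_nil abp) ltxx.
have [ax xb xbp] := itv_partition_cons_lt abp.
rewrite lte_fin -subr_gt0 metric_variation_cons => e0.
have [|h h0 Hh] := cg a _ _ e0; first by rewrite lexx ltW.
(* Staying below [x] keeps the rest of the partition valid; half of [h] keeps [u] strictly inside
   the continuity radius. *)
exists (Num.min x (a + h / 2)).
  by rewrite lt_min ax ge_min xb; lra.
move=> u /andP[au]; rewrite le_min => /andP[ux uh].
apply: lt_le_trans (curve_length_superadd _ ux xb).
apply: lt_le_trans (leeD (mdist_le_length _ ux) (metric_variation_le_length _ xbp)).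
have auh : mdist (g a) (g u) <
    mdist (g a) (g x) + metric_variation x b g p - V.
  apply: Hh; first by rewrite au (le_trans ux).
  by rewrite distrC ger0_norm; lra.
rewrite -EFinD lte_fin.
have := metric_triangle (g a) (g u) (g x); lra.
Qed.

Lemma within_itv_continuous_rev a b g : {within `[a, b], continuous g} ->
  {within `[- b, - a], continuous (fun t => g (- t))}.
Proof.
move=> /within_itv_continuousP cg; apply/within_itv_continuousP => u uab e e0.
have [|h h0 Hh] := cg (- u) _ _ e0; first lra.
by exists h => // v vab uv; apply: Hh; [lra|rewrite -opprD normrN].
Qed.

Lemma curve_length_lsc_left a b g (V : R) : a < b ->
  {within `[a, b], continuous g} -> (V%:E < curve_length a b g)%E ->
  exists2 s, a <= s < b &
    forall u, s <= u <= b -> (V%:E < curve_length a u g)%E.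
Proof.
move=> ab /within_itv_continuous_rev cg.
have revE u v : curve_length (- v) (- u) (fun t => g (- t)) = curve_length u v g.
  rewrite -(curve_length_rev u v 0) !sub0r; congr curve_length.
  by apply/funext => t; rewrite sub0r.
rewrite -revE => /(curve_length_lsc_right _ cg)[|s sab Hs]; first lra.
exists (- s); first lra.
by move=> u us; rewrite -revE; apply: Hs; lra.
Qed.

(** The parameter is the supremum [c] of those with arc length at most [t]. Semicontinuity from the
    left excludes a value above [t] at [c]; semicontinuity of the remaining length from the right,
    with additivity, excludes a value below [t]. *)
Lemma curve_length_ivt x y a b g (t : R) : rectifiable_curve x y a b g ->
  0 <= t -> (t%:E <= curve_length a b g)%E ->
  exists2 u, a <= u <= b & curve_length a u g = t%:E.
Proof.
move=> [[ab cg _ _] fing] t0 tl.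
have fin u v : a <= u -> u <= v -> v <= b -> curve_length u v g \is a fin_num.
  move=> au uv vb; rewrite ge0_fin_numE ?curve_length_ge0//.
  exact: le_lt_trans (curve_length_sub _ au uv vb) fing.
have subcg u v : a <= u -> v <= b -> {within `[u, v], continuous g}.
  move=> au vb; apply: continuous_subspaceW cg.
  by move=> r /=; rewrite !in_itv /=; lra.
pose S := [set u | a <= u <= b /\ (curve_length a u g <= t%:E)%E].
have Sa : S a by rewrite /S /= lexx ab curve_lengthxx lee_fin.
have supS : has_sup S.
  by split; [exists a|exists b => u [/andP[_]]].
set c := sup S.
have ac : a <= c by exact: sup_upper_bound.
have cb : c <= b by apply: ge_sup; [exists a|move=> u [/andP[_]]].
exists c; first by rewrite ac cb.
apply/eqP; rewrite eq_le; apply/andP; split; rewrite leNgt; apply/negP => lt_t.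
  (* Overshoot at [c]: the length would exceed [t] on a whole interval to the left of [c], where [S]
     still has points. *)
  have ltac : a < c.
    rewrite lt_neqAle ac andbT; apply/eqP => acE; move: lt_t.
    by rewrite -acE curve_lengthxx lte_fin ltNge t0.
  have [s /andP[as_ sc] Hs] := curve_length_lsc_left ltac (subcg _ _ (lexx a) cb) lt_t.
  have e0 : 0 < c - s by lra.
  have [u Su su] := sup_adherent e0 supS.
  have uc : u <= c by exact: sup_upper_bound.
  have := Hs u; rewrite -/c in su; have -> : s <= u <= c by lra.
  by move=> /(_ isT); rewrite ltNge; case: Su => _ ->.
have ltcb : c < b.
  rewrite lt_neqAle cb andbT; apply/eqP => cbE.
  by move: lt_t; rewrite cbE ltNge tl.
have lc : (fine (curve_length a c g))%:E = curve_length a c g by rewrite fineK// fin.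
have lcb : (fine (curve_length c b g))%:E = curve_length c b g by rewrite fineK// fin.
rewrite -lc lte_fin in lt_t.
(* Undershoot at [c]: the threshold is the length from [c] to [b] minus the deficit at [c]. If the
   length from [s] to [b] exceeds it, the length from [a] to [s] stays below [t], so some [s > c]
   lies in [S]. *)
have [|s /andP[cs sb] Hs] :=
    @curve_length_lsc_right c b g (fine (curve_length c b g) -
      (t - fine (curve_length a c g))) ltcb (subcg _ _ ac (lexx b)).
  by rewrite -lcb lte_fin; lra.
have : S s.
  split; first lra.
  have := Hs s; rewrite lexx (ltW cs) => /(_ isT).
  have as_ : a <= s by lra.
  move: (curve_length_cat g as_ sb) (curve_length_cat g ac cb).
  rewrite -lc -lcb -(fineK (fin _ _ (lexx a) as_ sb)).
  rewrite -(fineK (fin _ _ as_ sb (lexx b))) -(fineK (fin _ _ (lexx a) ab (lexx b))).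
  rewrite -!EFinD => -[->] [+]; rewrite lte_fin lee_fin; lra.
by move/(sup_upper_bound supS); rewrite -/c; lra.
Qed.

End arc_length.

(** * Bounds on line integrals along rectifiable curves *)

Section line_integral.

(** The integral of a nonnegative function is a supremum over the simple functions below it, hence
    monotone for arbitrary functions. This allows comparing [line_integral] with constants
    directly. *)
Lemma ge0_le_integral_nonmeas d (T : measurableType d) (R : realType)
    (mu : {measure set T -> \bar R}) (D : set T) (f1 f2 : T -> \bar R) :
  (forall x, D x -> (0 <= f1 x)%E) -> (forall x, D x -> (f1 x <= f2 x)%E) ->
  (\int[mu]_(x in D) f1 x <= \int[mu]_(x in D) f2 x)%E.
Proof.
move=> f10 f12; rewrite !(integral_mkcond D).
rewrite !ge0_integralTE; last 2 first.
- by move=> x; apply: erestrict_ge0 => y Dy; apply: le_trans (f12 _ Dy); exact: f10.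
- by move=> x; exact: erestrict_ge0.
apply: ge_ereal_sup => _ [h Hh <-]; apply: ereal_sup_ubound; exists h => //= x.
exact: le_trans (Hh x) (lee_restrict f12 x).
Qed.

Context {R : realType} {X : metricType R}.
Implicit Types (a b : R) (g : R -> X) (rho : X -> R).

(* By [curve_length_ivt] the infimum in [arc_length_param] is never that of the
   empty set. *)
Lemma arc_length_param_itv x y a b g (t : R) : rectifiable_curve x y a b g ->
  t \in `[0, fine (curve_length a b g)] ->
  exists2 u, a <= u <= b & arc_length_param a b g t = g u.
Proof.
move=> rg; rewrite in_itv /= => /andP[t0 tl]; have [[ab _ _ _] fing] := rg.
have [|u uab ul] := curve_length_ivt rg t0.
  by rewrite -(@fineK _ (curve_length a b g)) ?lee_fin// ge0_fin_numE// curve_length_ge0.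
exists (inf [set u | u \in `[a, b] /\ curve_length a u g = t%:E]) => //.
apply/andP; split.
  apply: lb_le_inf; first by exists u; rewrite /= in_itv.
  by move=> v [] /=; rewrite in_itv => /andP[].
apply: (@le_trans _ _ u); last by case/andP: uab.
apply: ge_inf; last by rewrite /= in_itv.
by exists a => v [] /=; rewrite in_itv => /andP[].
Qed.

Lemma integral_cst_itv (m l : R) : 0 <= l ->
  (\int[lebesgue_measure]_(t in `[0%R, l]) m%:E)%E = (m * l)%:E.
Proof.
move=> l0; rewrite integral_cst//= lebesgue_measure_itv /= lte_fin.
by rewrite oppr0 addr0 lt_neqAle l0 andbT; case: eqVneq => //= <-; rewrite mule0 mulr0.
Qed.

Lemma line_integral_ge rho (m : R) x y a b g : rectifiable_curve x y a b g ->
  0 <= m -> (forall u, a <= u <= b -> m <= rho (g u)) ->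
  ((m * fine (curve_length a b g))%:E <= line_integral rho a b g)%E.
Proof.
move=> rg m0 Hm; have [[ab _ _ _] _] := rg.
rewrite -integral_cst_itv ?fine_ge0 ?curve_length_ge0//.
apply: ge0_le_integral_nonmeas => t /=; rewrite ?lee_fin// => tl.
by have [u uab ->] := arc_length_param_itv rg tl; exact: Hm.
Qed.

Lemma line_integral_le rho (M : R) x y a b g : rectifiable_curve x y a b g ->
  (forall u, a <= u <= b -> 0 <= rho (g u) <= M) ->
  (line_integral rho a b g <= (M * fine (curve_length a b g))%:E)%E.
Proof.
move=> rg HM; have [[ab _ _ _] _] := rg.
rewrite -integral_cst_itv ?fine_ge0 ?curve_length_ge0//.
apply: ge0_le_integral_nonmeas => t /= tl; rewrite lee_fin;
  by have [u /HM/andP[? ?] ->] := arc_length_param_itv rg tl.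
Qed.

End line_integral.

(** * Crossing a level with control on everything before the crossing *)

Section first_hit.
Context {R : realType}.

(** The point [s] ends the longest initial interval on which [f <= c]; [f] may touch [c] before it.
    Continuity excludes [f s > c], since [f <= c] just before [s], and [f s < c], since the interval
    could then be extended. *)
Lemma first_hit (f : R -> R) (a b c : R) : a <= b ->
  {within `[a, b], continuous f} -> f a <= c <= f b ->
  exists s, [/\ a <= s <= b, f s = c & forall u, a <= u <= s -> f u <= c].
Proof.
move=> ab /(@within_itv_continuousP R R^o) cf /andP[fa fb].
pose S := [set u | a <= u <= b /\ forall v, a <= v <= u -> f v <= c].
have Sa : S a.
  split; first by rewrite lexx.
  by move=> v /le_anti <-.
have supS : has_sup S by split; [exists a|exists b => u [/andP[_]]].
set s := sup S.
have as_ : a <= s by exact: sup_upper_bound.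
have sb : s <= b by apply: ge_sup; [exists a|move=> u [/andP[_]]].
have below u : a <= u -> u < s -> f u <= c.
  move=> au us; have e0 : 0 < s - u by rewrite subr_gt0.
  have [v [vab Hv] uv] := sup_adherent e0 supS.
  by apply: Hv; rewrite -/s in uv; lra.
have sab : a <= s <= b by rewrite as_.
have fs : f s <= c.
  rewrite leNgt; apply/negP => cfs.
  have [h h0 Hh] := cf _ sab _ (ltac:(by rewrite subr_gt0) : 0 < f s - c).
  have [sa|ltas] : s = a \/ a < s by move: as_; rewrite le_eqVlt => /predU1P[]; auto.
    by move: cfs; rewrite sa ltNge fa.
  pose v := Num.max a (s - h / 2).
  have vs : v < s by rewrite /v gt_max ltas; lra.
  have av : a <= v by rewrite /v le_max lexx.
  have hv : s - h / 2 <= v by rewrite /v le_max lexx orbT.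
  have := Hh v; have -> : a <= v <= b by lra.
  rewrite ger0_norm; last lra.
  move=> /(_ isT (ltac:(lra) : s - v < h)); rewrite /mdist /= distrC.
  by move=> /(le_lt_trans (ler_norm _)); have := below v av vs; lra.
exists s; split=> //; last first.
  by move=> u /andP[au]; rewrite le_eqVlt => /predU1P[->//|]; exact: below.
apply/eqP; rewrite eq_le fs /= leNgt; apply/negP => fsc.
have [h h0 Hh] := cf _ sab _ (ltac:(by rewrite subr_gt0) : 0 < c - f s).
have [sE|ltsb] : s = b \/ s < b by move: sb; rewrite le_eqVlt => /predU1P[]; auto.
  by move: fsc; rewrite sE ltNge fb.
pose v := Num.min b (s + h / 2).
have vs : s < v by rewrite /v lt_min ltsb; lra.
have vb : v <= b by rewrite /v ge_min lexx.
have hv : v <= s + h / 2 by rewrite /v ge_min lexx orbT.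
suff /(sup_upper_bound supS) : S v by rewrite -/s; lra.
split; first lra.
move=> u /andP[au uv]; have [us|su] := leP u s.
  by move: us; rewrite le_eqVlt => /predU1P[->//|]; exact: below.
have := Hh u; have -> : a <= u <= b by lra.
rewrite distrC ger0_norm; last lra.
move=> /(_ isT (ltac:(lra) : u - s < h)); rewrite /mdist /=.
by move=> /(le_lt_trans (ler_norm _)); lra.
Qed.

End first_hit.

(** * The distance to the metric boundary is positive and 1-Lipschitz *)

Section boundary_distance.
Context {R : realType} {X : metricType R} (cX : metric_completion X).
Hypothesis niceX : minimally_nice X.
Local Notation delta := (bdist cX).
Local Notation bd := (@metric_boundary R X cX).

(** If the boundary were empty, limits in the completion of Cauchy filters of [X] would lie in [X],
    against incompleteness. Hence [bdist] is never the default infimum of an empty set. *)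
Lemma metric_boundary_neq0 : bd !=set0.
Proof.
case: niceX => _ incX _ _; apply: contra_notP incX => /set0P/negP.
rewrite negbK => /eqP bd0 F PF /cauchyP cF.
have /(@cpl_complete _ _ cX)[l Fl] : cauchy (cpl_emb cX @ F).
  apply/cauchyP => e e0; have [x Fx] := cF _ e0; exists (cpl_emb cX x).
  rewrite fmapE; apply: filterS Fx => y.
  by rewrite /preimage /= !ballEmdist /= cpl_isometry.
have [x _ xl] : range (cpl_emb cX) l.
  by apply: contrapT => Nl; have : bd l by []; rewrite bd0.
exists x; apply/fcvgrPdist_lt => e e0.
move/cvgrPdist_lt : Fl => /(_ _ e0); rewrite -xl; apply: filterS => y.
by rewrite cpl_isometry.
Qed.

Lemma bdist_lbound z : has_lbound [set mdist (cpl_emb cX z) w | w in bd].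
Proof. by exists 0 => _ [w _ <-]; exact: mdist_ge0. Qed.

Lemma bdist_image_neq0 z :
  [set mdist (cpl_emb cX z) w | w in bd] !=set0.
Proof.
by have [w bw] := metric_boundary_neq0; exists (mdist (cpl_emb cX z) w), w.
Qed.

Lemma bdist_lipschitz x y : delta x <= delta y + mdist x y.
Proof.
rewrite -lerBlDr; apply: lb_le_inf; first exact: bdist_image_neq0.
move=> _ [w bw <-]; rewrite lerBlDr.
apply: (@le_trans _ _ (mdist (cpl_emb cX x) w)).
  by apply: ge_inf; [exact: bdist_lbound|exists w].
by rewrite addrC -(@cpl_isometry _ _ cX) metric_triangle.
Qed.

Lemma cpl_emb_continuous : continuous (cpl_emb cX).
Proof.
move=> x; apply/cvgrPdist_lt => e e0; apply/nbhs_ballP.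
by exists e => // y /=; rewrite ballEmdist cpl_isometry.
Qed.

(** A compact neighbourhood [U] of [z] contains a ball of some radius [r], and its image in the
    completion is closed. A boundary point closer than [r] to [z] would be a limit of points of [U],
    hence in that image. *)
Lemma bdist_gt0 z : 0 < delta z.
Proof.
case: niceX => lcX _ _ _.
have [U zU [cU _]] := lcX z I.
have [r r0 rU] : exists2 r, 0 < r & forall x, mdist z x < r -> U x.
  have [r r0 rU] : nbhs_ball z U.
    apply/nbhs_ballP; move: zU; rewrite /within /= => zU.
    by apply: filterS zU => x; exact.
  by exists r => // x zx; apply: rU; rewrite ballEmdist.
apply: lt_le_trans r0 _; apply: lb_le_inf; first exact: bdist_image_neq0.
move=> _ [w bw <-]; rewrite leNgt; apply/negP => zw; apply: bw.
have clU : closed (cpl_emb cX @` U).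
  apply: compact_closed; first exact: metric_hausdorff.
  apply: continuous_compact => //; apply: continuous_subspaceT.
  exact: cpl_emb_continuous.
suff /clU[x _ <-] : closure (cpl_emb cX @` U) w by exists x.
move=> B /nbhs_ballP[e e0 eB].
(* A point of [X] within [h] of [w] lies both in the given neighbourhood of [w] and within [r] of
   [z]. *)
set h := Num.min e (r - mdist (cpl_emb cX z) w).
have h0 : 0 < h by rewrite lt_min e0 subr_gt0.
have [||q [/interior_subset wq [x _ xq]]] := @cpl_dense _ _ cX (interior (ball w h)).
- by exists w; exact: nbhsx_ballx.
- exact: open_interior.
move: wq; rewrite ballEmdist /= -xq lt_min => /andP[wxe wxr].
exists q; split; rewrite -xq; last by apply: eB; rewrite ballEmdist.
exists x => //; apply: rU => /=; rewrite -(@cpl_isometry _ _ cX).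
by apply: le_lt_trans (metric_triangle _ w _) _; rewrite -ltrBrDl.
Qed.

End boundary_distance.

(** * Quasihyperbolic geodesics: metric estimates, Harnack inequality, rectifiability *)

Section quasihyperbolic_geodesics.
Context {R : realType} {X : metricType R} (cX : metric_completion X).
Hypothesis niceX : minimally_nice X.
Local Notation delta := (bdist cX).
Implicit Types (x y : X) (g : R -> X).

(* Along a curve of length [l] starting at [x], [delta <= delta x + l], so its
   quasihyperbolic length is at least [l / (delta x + l)].  This replaces the
   usual bound [ln (1 + l / delta x)] and suffices at small scales. *)
Lemma qhdist_ge x y :
  ((mdist x y / (delta x + mdist x y))%:E <= qhdist cX x y)%E.
Proof.
apply: le_ereal_inf_tmp => _ [a [b [g [rg ->]]]].
have [[ab _ gx gy] fing] := rg.
set l := fine (curve_length a b g).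
have lE : curve_length a b g = l%:E.
  by rewrite fineK// ge0_fin_numE// curve_length_ge0.
have dl : mdist x y <= l by rewrite -lee_fin -lE -gx -gy mdist_le_length.
have dx0 := bdist_gt0 cX niceX x; have d0 := mdist_ge0 x y.
have l0 : 0 <= l by exact: le_trans dl.
(* The bound [l / (delta x + l)] increases with [l], so [l] may be replaced by the smaller
   [mdist x y]. *)
apply: le_trans (line_integral_ge (m := (delta x + l)^-1)
  (rho := fun z => (delta z)^-1) rg _ _); rewrite -/l.
- rewrite lee_fin [leRHS]mulrC ler_pdivlMr; last lra.
  rewrite mulrAC ler_pdivrMr; last lra.
  by rewrite !mulrDr (mulrC l (mdist _ _)) lerD2r ler_wpM2r// ltW.
- by rewrite invr_ge0; lra.
- move=> u /andP[au ub]; rewrite lef_pV2 ?posrE ?(bdist_gt0 cX niceX)//; last lra.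
  apply: le_trans (bdist_lipschitz cX niceX _ x) _; rewrite lerD2l metric_sym.
  rewrite -lee_fin -lE -gx; apply: le_trans (mdist_le_length g au) _.
  exact: curve_length_sub.
Qed.

Lemma qhdist_le x y a b g (m : R) : rectifiable_curve x y a b g -> 0 < m ->
  (forall u, a <= u <= b -> m <= delta (g u)) ->
  (qhdist cX x y <= (m^-1 * fine (curve_length a b g))%:E)%E.
Proof.
move=> rg m0 Hm; apply: le_trans (line_integral_le (rho := fun z => (delta z)^-1) rg _).
  by apply: ereal_inf_lbound; exists a, b, g.
move=> u uab; rewrite invr_ge0 ltW ?(bdist_gt0 cX niceX)//=.
by rewrite lef_pV2 ?posrE ?(bdist_gt0 cX niceX)// Hm.
Qed.

Lemma qh_geodesic_dist x y (L : R) g s t : qh_geodesic cX x y L g ->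
  0 <= s <= L -> 0 <= t <= L -> qhdist cX (g s) (g t) = `|s - t|%:E.
Proof. by move=> [_ _ _ H] sL tL; apply: H; rewrite in_itv. Qed.

Lemma qh_geodesic_sub x y (L : R) g u v : qh_geodesic cX x y L g ->
  0 <= u -> u <= v -> v <= L ->
  qh_geodesic cX (g u) (g v) (v - u) (fun t => g (u + t)).
Proof.
move=> gg u0 uv vL; split; rewrite ?subr_ge0 ?addr0 ?subrKC// => s t.
rewrite !in_itv /= => sI tI; rewrite (qh_geodesic_dist gg); [|lra|lra].
by congr (`|_|%:E); ring.
Qed.

Lemma qh_geodesic_rev x y (L : R) g : qh_geodesic cX x y L g ->
  qh_geodesic cX y x L (fun t => g (L - t)).
Proof.
move=> gg; have [L0 gx gy _] := gg.
split; rewrite ?subr0 ?subrr// => s t; rewrite !in_itv /= => sI tI.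
rewrite (qh_geodesic_dist gg); [|lra|lra].
by rewrite distrC; congr (`|_|%:E); ring.
Qed.

(** With [m] the distance and [h = |s - t|], [qhdist_ge] gives [m <= h (delta (g s) + m)]; since
    [h <= 1/2], the term [h m] is absorbed, which costs the factor 2. *)
Lemma qh_geodesic_lipschitz x y (L : R) g s t : qh_geodesic cX x y L g ->
  0 <= s <= L -> 0 <= t <= L -> `|s - t| <= 2^-1 ->
  mdist (g s) (g t) <= 2 * `|s - t| * delta (g s).
Proof.
move=> gg sL tL st; have := qhdist_ge (g s) (g t).
rewrite (qh_geodesic_dist gg)// lee_fin.
have d0 := bdist_gt0 cX niceX (g s); have m0 := mdist_ge0 (g s) (g t).
rewrite ler_pdivrMr; last lra.
have : `|s - t| * mdist (g s) (g t) <= 2^-1 * mdist (g s) (g t) by exact: ler_wpM2r.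
by rewrite mulrDr; lra.
Qed.

(** A step of quasihyperbolic length at most 1/2 moves the point by at most [delta (g s)], so it at
    most doubles [delta]; the way from [s] to [t] is cut into [n] equal steps. *)
Lemma qh_geodesic_harnack x y (L : R) g (n : nat) s t : qh_geodesic cX x y L g ->
  0 <= s <= L -> 0 <= t <= L -> `|s - t| <= n%:R / 2 ->
  delta (g t) <= 2 ^+ n * delta (g s).
Proof.
move=> gg; elim: n s t => [|n IH] s t sL tL.
  by rewrite mul0r normr_le0 subr_eq0 => /eqP ->; rewrite mul1r.
move=> st; pose u := s + (t - s) / n.+1%:R.
have n0 : 0 < n.+1%:R :> R by rewrite ltr0n.
have w01 : 0 <= (n.+1%:R : R)^-1 <= 1.
  by rewrite invr_ge0 ler0n invf_le1// ler1n.
have uL : 0 <= u <= L.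
  (* [u] is a convex combination of [s] and [t]; the signs of the products involved are supplied to
     make the goal linear. *)
  rewrite /u; move: w01; set w := _^-1 => /andP[w0 w1].
  have c r : 0 <= r -> 0 <= w * r by exact: mulr_ge0.
  have c' r : 0 <= r -> 0 <= (1 - w) * r by apply: mulr_ge0; lra.
  have := c t; have := c' s; have := c (L - t); have := c' (L - s).
  by move=> *; lra.
have nE : n.+1%:R = n%:R + 1 :> R by rewrite natr1.
have su : `|s - u| <= 2^-1.
  rewrite /u opprD addrA subrr sub0r normrN normrM normfV (gtr0_norm n0).
  by rewrite ler_pdivrMr// mulrC distrC.
have ut : `|u - t| <= n%:R / 2.
  have -> : u - t = (s - t) * (n%:R / n.+1%:R).
    by rewrite /u nE; field; rewrite -nE gt_eqF.
  rewrite normrM (ger0_norm (_ : 0 <= n%:R / _)) ?divr_ge0 ?ler0n//.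
  apply: (@le_trans _ _ (n.+1%:R / 2 * (n%:R / n.+1%:R))).
    by rewrite ler_wpM2r// divr_ge0 ?ler0n.
  by rewrite le_eqVlt; apply/orP; left; apply/eqP; rewrite nE; field; rewrite -nE gt_eqF.
apply: le_trans (IH u t uL tL ut) _.
rewrite exprSr -mulrA ler_wpM2l ?exprn_ge0//.
have := qh_geodesic_lipschitz gg sL uL su; have := bdist_lipschitz cX niceX (g u) (g s).
have : 2 * `|s - u| * delta (g s) <= 2 * 2^-1 * delta (g s).
  by apply: ler_wpM2r; [exact/ltW/bdist_gt0|exact: ler_wpM2l].
by rewrite (metric_sym (g u)) => *; lra.
Qed.

Lemma qh_geodesic_continuous x y (L : R) g : qh_geodesic cX x y L g ->
  {within `[0, L], continuous g}.
Proof.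
move=> gg; apply/within_itv_continuousP => u uL e e0.
have d0 := bdist_gt0 cX niceX (g u).
exists (Num.min 2^-1 (e / (2 * delta (g u)))).
  by rewrite lt_min invr_gt0 ltr0n divr_gt0// mulr_gt0.
move=> v vL; rewrite lt_min => /andP[/ltW uv].
rewrite ltr_pdivlMr ?mulr_gt0// => uve.
by apply: le_lt_trans (qh_geodesic_lipschitz gg uL vL uv) _; rewrite mulrAC mulrC.
Qed.

Lemma qh_geodesic_bdist_continuous x y (L : R) g u v : qh_geodesic cX x y L g ->
  0 <= u -> v <= L -> {within `[u, v], continuous (delta \o g)}.
Proof.
move=> /qh_geodesic_continuous/within_itv_continuousP cg u0 vL.
apply/(@within_itv_continuousP R R^o) => s suv e e0.
have [|h h0 Hh] := cg s _ e e0; first lra.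
exists h => // t tuv /(Hh t)/le_lt_trans st; apply: st; last lra.
rewrite ler_norml; have := bdist_lipschitz cX niceX (g s) (g t).
have := bdist_lipschitz cX niceX (g t) (g s).
by rewrite (metric_sym (g t)) /= => *; lra.
Qed.

Lemma qh_geodesic_length x y (L : R) g (u v M : R) : qh_geodesic cX x y L g ->
  0 <= u -> u <= v -> v <= L ->
  (forall t, u <= t <= v -> delta (g t) <= M) ->
  (curve_length u v g <= (2 * M * (v - u))%:E)%E.
Proof.
move=> gg u0 uv vL HM; apply: (@curve_length_lipschitz _ _ _ _ _ _ 2^-1) => //.
move=> s t us st tv h.
have st_ : `|s - t| = t - s by rewrite distrC ger0_norm// subr_ge0.
have := @qh_geodesic_lipschitz _ _ _ _ s t gg; rewrite st_ => /(_ _ _ _)/le_trans; apply.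
- lra.
- lra.
- by [].
- by rewrite mulrAC ler_wpM2r ?subr_ge0// ler_wpM2l// HM//; lra.
Qed.

Lemma qh_geodesic_rectifiable x y (L : R) g : qh_geodesic cX x y L g ->
  rectifiable_curve x y 0 L g.
Proof.
move=> gg; have [L0 gx gy _] := gg; have cg := qh_geodesic_continuous gg.
split; first by split.
have [c _ Hc] := EVT_max L0 (qh_geodesic_bdist_continuous gg (lexx 0) (lexx L)).
have HM t : 0 <= t <= L -> delta (g t) <= delta (g c).
  by move=> tL; apply: Hc; rewrite in_itv.
apply: le_lt_trans (qh_geodesic_length gg (lexx 0) L0 (lexx L) HM) (ltry _).
Qed.

Lemma qh_geodesic_inj x y (L : R) g : qh_geodesic cX x y L g ->
  {in `[0, L] &, injective g}.
Proof.
move=> gg s t; rewrite !in_itv /= => sL tL gst.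
have := qh_geodesic_dist gg sL tL; rewrite gst (qh_geodesic_dist gg tL tL).
rewrite subrr normr0 => -[] /esym/eqP.
by rewrite normr_eq0 subr_eq0 => /eqP.
Qed.

(** * From the cone condition to bounded quasihyperbolic length *)

Section John_implies_bounded.
Variables (a : R) (x y : X) (L : R) (g : R -> X).
Hypothesis a1 : 1 <= a.
Hypothesis gg : qh_geodesic cX x y L g.
Hypothesis coneg : double_cone_arc cX a x y 0 L g.
Local Notation r := (Num.min (delta x) (delta y)).
Hypothesis gr : {in `[0, L], forall t, delta (g t) <= 2 * r}.

Let L0 : 0 <= L. Proof. by case: gg. Qed.
Let r0 : 0 < r. Proof. by rewrite lt_min !(bdist_gt0 cX niceX). Qed.

(** At each point the cone condition bounds one of the two subarcs by [2 a r]. Walking along the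
    geodesic in steps of 1/4, the bounded side switches within one step, whose length is at most
    [r <= a r]; hence [2 + 1 + 2 = 5]. *)
Lemma cone_arc_length : (curve_length 0 L g <= (5 * a * r)%:E)%E.
Proof.
have rar : r <= a * r by rewrite ler_peMl// ltW.
(* Since [delta <= 2 r], the speed is at most [4 r], so a quarter step has length at most [r]. *)
have step u v : 0 <= u -> u <= v -> v <= L -> v - u <= 4^-1 ->
    (curve_length u v g <= r%:E)%E.
  move=> u0 uv vL uv4.
  apply: le_trans (qh_geodesic_length (M := 2 * r) gg u0 uv vL _) _.
    by move=> t tI; apply: gr; rewrite in_itv /=; lra.
  have : 2 * (2 * r) * (v - u) <= 2 * (2 * r) * 4^-1.
    by apply: ler_wpM2l => //; have := r0; lra.
  by rewrite lee_fin; lra.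
have cone u : 0 <= u <= L ->
    (curve_length 0 u g <= (2 * a * r)%:E)%E \/
    (curve_length u L g <= (2 * a * r)%:E)%E.
  move=> uL; have uL' : u \in `[0, L] by rewrite in_itv.
  have [_ /(_ u uL')] := coneg.
  have : ((a * delta (g u))%:E <= (2 * a * r)%:E)%E.
    rewrite lee_fin -mulrA mulrCA; apply: ler_wpM2l; last exact: gr.
    by apply: le_trans a1.
  by rewrite ge_min => H /orP[] /le_trans/(_ H); [left|right].
suff H n : n%:R / 4 <= L ->
    (curve_length 0 (n%:R / 4) g <= (2 * a * r)%:E)%E \/
    (curve_length 0 L g <= (5 * a * r)%:E)%E.
  have /andP[nL Ln] : (Num.truncn (4 * L))%:R <= 4 * L < (Num.truncn (4 * L)).+1%:R.
    by rewrite truncn_le ?mulr_ge0// truncnS_gt.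
  (* The last grid point [n / 4] leaves less than one step up to [L]. *)
  set n := Num.truncn (4 * L) in nL Ln.
  have nL4 : n%:R / 4 <= L by lra.
  case: (H n nL4) => // Hn.
  have n0 : 0 <= n%:R / 4 :> R by rewrite divr_ge0.
  apply: le_trans (curve_length_subadd g n0 nL4) _.
  apply: le_trans (leeD Hn (step _ _ n0 nL4 (lexx L) _)) _.
    by rewrite -natr1 in Ln; lra.
  by rewrite -EFinD lee_fin; have := r0; lra.
elim: n => [|n IH].
  move=> _; left; rewrite mul0r curve_lengthxx lee_fin.
  by have := r0; lra.
rewrite -natr1 => nL.
have nL4 : n%:R / 4 <= L by lra.
case: (IH nL4) => [Hn|]; last by right.
set v := (n%:R + 1) / 4.
have n0 : 0 <= n%:R / 4 :> R by rewrite divr_ge0.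
have nv : n%:R / 4 <= v by rewrite /v; lra.
have [|Hv|Hv] := cone v; first by rewrite /v; lra.
  by left.
right.
apply: le_trans (curve_length_subadd g (le_trans n0 nv) nL) _.
apply: le_trans (leeD (curve_length_subadd g n0 nv) Hv) _.
apply: le_trans (leeD (leeD Hn (step _ _ n0 nv nL _)) (lexx _)) _.
  by rewrite /v; lra.
by rewrite -!EFinD lee_fin; lra.
Qed.

(** If one of the subarcs has length at most [r / 2], the Lipschitz property from that endpoint
    gives [delta >= r / 2]. Otherwise both exceed [r / 2], and the cone condition gives
    [r / 2 < a * delta (g u)]. *)
Lemma cone_arc_bdist u : 0 <= u <= L -> r / (2 * a) <= delta (g u).
Proof.
move=> uL; have /andP[u0 uL'] := uL; have a0 := lt_le_trans ltr01 a1.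
have [_ gx gy _] := gg.
have rle : r / (2 * a) <= r / 2.
  by rewrite ler_pM2l// lef_pV2 ?posrE//; have := a1; lra.
have [lu|lu] := leP (curve_length 0 u g) (r / 2)%:E.
  have : mdist x (g u) <= r / 2.
    by rewrite -lee_fin; apply: le_trans lu; rewrite -gx mdist_le_length.
  have := bdist_lipschitz cX niceX x (g u).
  have : r <= delta x by rewrite ge_min lexx.
  lra.
have [ul|ul] := leP (curve_length u L g) (r / 2)%:E.
  have : mdist (g u) y <= r / 2.
    by rewrite -lee_fin; apply: le_trans ul; rewrite -gy mdist_le_length.
  have := bdist_lipschitz cX niceX y (g u); rewrite (metric_sym y).
  have : r <= delta y by rewrite ge_min lexx orbT.
  lra.
have [_ /(_ u)] := coneg; rewrite in_itv /= => /(_ uL).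
have : ((r / 2)%:E < Order.min (curve_length 0 u g) (curve_length u L g))%E.
  by rewrite lt_min lu ul.
move=> /lt_le_trans h /h; rewrite lte_fin => ra.
by rewrite ler_pdivrMr ?mulr_gt0//; lra.
Qed.

(** Length at most [5 a r] divided by boundary distance at least [r / (2 a)] gives [10 a ^ 2]. *)
Lemma cone_arc_qh_length : (qhdist cX x y <= (10 * a ^+ 2)%:E)%E.
Proof.
have a0 := lt_le_trans ltr01 a1.
have m0 : 0 < r / (2 * a) by rewrite divr_gt0 ?mulr_gt0.
apply: le_trans (qhdist_le (qh_geodesic_rectifiable gg) m0 cone_arc_bdist) _.
have := cone_arc_length.
have [_] := qh_geodesic_rectifiable gg.
move: (curve_length_ge0 g L0); case: (curve_length 0 L g) => [l| |]//= _ _.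
rewrite !lee_fin => lr; rewrite invf_div mulrAC ler_pdivrMr//.
have := r0; set rr := r => rr0.
have : 2 * a * l <= 2 * a * (5 * a * rr) by apply: ler_wpM2l => //; lra.
by move/le_trans; apply; rewrite le_eqVlt; apply/orP; left; apply/eqP; ring.
Qed.

End John_implies_bounded.

(** * From bounded geodesics to the cone condition *)

Section bounded_implies_John.
Variables (A : R) (N : nat).
Hypothesis A0 : 0 < A.
Hypothesis AN : 2 * A <= N%:R.
Hypothesis bA : qh_bounded_geodesics cX A.

Lemma bounded_subgeodesic x y (L : R) g s t : qh_geodesic cX x y L g ->
  0 <= s -> s <= t -> t <= L ->
  (forall u, s <= u <= t -> delta (g u) <= 2 * Num.min (delta (g s)) (delta (g t))) ->
  t - s <= A.
Proof.
move=> gg s0 st tL H; have := bA (qh_geodesic_sub gg s0 st tL).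
rewrite (qh_geodesic_dist gg); [|lra|lra].
rewrite distrC ger0_norm ?subr_ge0// lee_fin; apply.
by move=> u; rewrite in_itv /= => uI; apply: H; lra.
Qed.

(* [s] and [t'] are the first points of the geodesic at which [delta] reaches
   [M / 2] and, past [t], [M]: the hypothesis applies between them. *)
Lemma bounded_geodesic_halving x y (L t0 M t : R) g :
  qh_geodesic cX x y L g -> t0 <= L -> 0 <= t <= t0 ->
  (forall u, 0 <= u <= t -> delta (g u) <= M) -> M <= delta (g t0) ->
  exists s, [/\ 0 <= s, s <= t -> (curve_length s t g <= (2 * A * M)%:E)%E &
    s = 0 \/ M / 2 <= delta (g s) /\ forall u, 0 <= u <= s -> delta (g u) <= M / 2].
Proof.
move=> gg t0L /andP[tge tt0] HM Mt0.
have cf u v := @qh_geodesic_bdist_continuous _ _ _ _ u v gg.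
have M0 : 0 < M.
  by apply: lt_le_trans (bdist_gt0 cX niceX (g 0)) (HM _ _); rewrite lexx tge.
have [|t' [tt' /= ft' Ht']] := @first_hit R (delta \o g) t t0 M tt0 (cf _ _ tge t0L).
  by rewrite /= Mt0 HM// lexx tge.
have Ht0 u : 0 <= u <= t' -> delta (g u) <= M.
  move=> /andP[u0 ut']; have [ut|tu] := leP u t; first by apply: HM; rewrite u0.
  by apply: Ht'; rewrite ut' ltW.
have short s : 0 <= s -> M / 2 <= delta (g s) -> s <= t ->
    (curve_length s t g <= (2 * A * M)%:E)%E.
  move=> s0 fs st; apply: le_trans (qh_geodesic_length (M := M) gg s0 st _ _) _.
  - lra.
  - by move=> u uI; apply: HM; lra.
  rewrite lee_fin mulrAC ler_pM2r// ler_pM2l//.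
  apply: (@le_trans _ _ (t' - s)); first lra.
  apply: (bounded_subgeodesic gg) => [||| u uI]; [lra|lra|lra|].
  (* On [[s, t']] one has [delta <= M], while the end values are at least [M / 2] and exactly
     [M]. *)
  apply: (@le_trans _ _ M); first by apply: Ht0; lra.
  by rewrite -ler_pdivrMl// mulrC le_min fs ft'; lra.
have [f0|f0] := leP (M / 2) (delta (g 0)).
  by exists 0; split; [|exact: short|left].
have t'0 : 0 <= t' by lra.
have t'L : t' <= L by lra.
(* The search runs up to [t'], where [delta] is [M], because [delta] may stay below [M / 2] up to
   [t]. Thus [s] may lie beyond [t]. *)
have [|s [/andP[s0 st'] /= fs Hs]] :=
    @first_hit R (delta \o g) 0 t' (M / 2) t'0 (cf _ _ (lexx 0) t'L).
  by rewrite /= ft' ltW//=; lra.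
by exists s; rewrite -{1}fs; split=> //; [apply: short; rewrite ?fs|right; rewrite fs].
Qed.

(** One halving costs [2 A M] and leaves the same problem with [M / 2], so
    [2 A M + 4 A (M / 2) = 4 A M]. The induction is on the number of halvings after which [M] would
    fall below [delta (g 0)]. *)
Lemma bounded_geodesic_length x y (L t0 M t : R) g :
  qh_geodesic cX x y L g -> t0 <= L -> 0 <= t <= t0 ->
  (forall u, 0 <= u <= t -> delta (g u) <= M) -> M <= delta (g t0) ->
  (curve_length 0 t g <= (4 * A * M)%:E)%E.
Proof.
move=> gg t0L; have f0 := bdist_gt0 cX niceX (g 0).
suff H n : forall M' t' : R, 0 <= t' <= t0 ->
    (forall u : R, 0 <= u <= t' -> delta (g u) <= M') -> M' <= delta (g t0) ->
    M' / delta (g 0) < 2 ^+ n -> (curve_length 0 t' g <= (4 * A * M')%:E)%E.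
  move=> tI HM Mt0.
  apply: (H (Num.truncn (M / delta (g 0))).+1) => //.
  apply: lt_trans (truncnS_gt _) _.
  by rewrite -natrX ltr_nat ltn_expl.
elim: n => [|n IH] {}M {}t tI HM Mt0; rewrite ltr_pdivrMr// => Mn.
  (* Zero halvings cannot occur: [M] would be smaller than [delta (g 0)]. *)
  by move: Mn; rewrite mul1r ltNge HM// lexx; case/andP: tI.
have [t0' _] := andP tI.
have M0 : 0 < M by apply: lt_le_trans f0 (HM _ _); rewrite lexx.
have AM : 0 < A * M by rewrite mulr_gt0.
have [s [s0 Hst]] := bounded_geodesic_halving gg t0L tI HM Mt0.
move=> [sE|[fs Hs]].
  rewrite sE in Hst; apply: le_trans (Hst t0') _.
  by rewrite lee_fin; lra.
have Mn2 : M / 2 / delta (g 0) < 2 ^+ n.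
  by rewrite ltr_pdivrMr// ltr_pdivrMr// mulrAC -exprSr.
(* If [delta] has stayed below [M / 2] up to [t], induction applies to [t] itself; otherwise it
   applies to [s]. *)
have [ts|st] := leP t s.
  apply: (@le_trans _ _ (4 * A * (M / 2))%:E).
    apply: IH => // [u uI|]; last lra.
    by apply: Hs; lra.
  by rewrite lee_fin; lra.
apply: le_trans (curve_length_subadd g s0 (ltW st)) _.
apply: (@le_trans _ _ ((4 * A * (M / 2))%:E + (2 * A * M)%:E)%E).
  apply: leeD; last exact/Hst/ltW.
  by apply: IH => //; lra.
by rewrite -EFinD lee_fin; lra.
Qed.

(** The length up to [t] is at most [4 A M] with [M] the maximum of [delta] on [[0, t]]. This
    maximum is attained at some [t1 <= t] and again at some [t' >= t], with [delta <= M] between, so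
    [t' - t1 <= A] and the Harnack inequality bounds [M] by [2 ^ N * delta (g t)]. The summand 1
    makes the cone constant at least 1. *)
Lemma bounded_geodesic_half_cone x y (L t0 t : R) g :
  qh_geodesic cX x y L g -> 0 <= t <= t0 -> t0 <= L ->
  (forall u, 0 <= u <= L -> delta (g u) <= delta (g t0)) ->
  (curve_length 0 t g <= ((1 + 4 * A * 2 ^+ N) * delta (g t))%:E)%E.
Proof.
move=> gg tI t0L Hmax; have /andP[tge tt0] := tI.
have cf u v := @qh_geodesic_bdist_continuous _ _ _ _ u v gg.
have tL : t <= L by lra.
have [t1] := EVT_max tge (cf _ _ (lexx 0) tL).
rewrite in_itv /= => /andP[t10 t1t] Hm.
set M := delta (g t1) in Hm.
have HM u : 0 <= u <= t -> delta (g u) <= M by move=> uI; apply: Hm; rewrite in_itv.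
have Mt0 : M <= delta (g t0) by apply: Hmax; lra.
have M0 : 0 < M by exact: bdist_gt0.
have d0 := bdist_gt0 cX niceX (g t).
have [|t' [tt' /= ft' Ht']] := @first_hit R (delta \o g) t t0 M tt0 (cf _ _ tge t0L).
  by rewrite /= Mt0 HM// lexx tge.
have t't1 : t' - t1 <= A.
  apply: (bounded_subgeodesic gg) => [||| u uI]; [lra|lra|lra|].
  rewrite ft' -/M minxx; apply: (@le_trans _ _ M); last lra.
  have [ut|tu] := leP u t; first by apply: HM; lra.
  by apply: Ht'; lra.
have MN : M <= 2 ^+ N * delta (g t).
  rewrite -ft'; apply: (qh_geodesic_harnack gg); [lra|lra|].
  by rewrite distrC ger0_norm; have := AN; lra.
apply: le_trans (bounded_geodesic_length gg t0L tI HM Mt0) _.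
rewrite lee_fin; have : 4 * A * M <= 4 * A * (2 ^+ N * delta (g t)).
  by apply: ler_wpM2l => //; have := A0; lra.
by move/le_trans; apply; rewrite mulrA ler_wpM2r//; lra.
Qed.

Lemma bounded_qh_John : qh_John cX (1 + 4 * A * 2 ^+ N).
Proof.
move=> x y L g gg; have [L0 gx gy _] := gg.
split; first split.
- by split; rewrite //; exact: qh_geodesic_continuous gg.
- exact: qh_geodesic_inj gg.
have [t0] := EVT_max L0 (qh_geodesic_bdist_continuous gg (lexx 0) (lexx L)).
rewrite in_itv /= => /andP[t00 t0L] Hmax t; rewrite in_itv /= => /andP[t_0 tL].
have {}Hmax u : 0 <= u <= L -> delta (g u) <= delta (g t0).
  by move=> uL; apply: Hmax; rewrite in_itv.
rewrite ge_min; apply/orP; have [tt0|t0t] := leP t t0; [left|right].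
  by apply: (bounded_geodesic_half_cone gg _ t0L Hmax); rewrite t_0.
(* Past the maximum, the half-cone estimate is applied to the reversed geodesic; its initial
   parameter 0 is written [L - L] so that [curve_length_rev] applies. *)
have := @bounded_geodesic_half_cone _ _ L (L - t0) (L - t) _ (qh_geodesic_rev gg).
rewrite /= !subKr -[X in curve_length X _ _](subrr L) curve_length_rev.
apply; [lra|lra|].
by move=> u uI; apply: Hmax; lra.
Qed.

End bounded_implies_John.

End quasihyperbolic_geodesics.

Theorem theorem1p2 (R : realType) :
  (forall (X : metricType R) (cX : metric_completion X), minimally_nice X ->
     ((exists a : R, 1 <= a /\ qh_John cX a) <->
      (exists A : R, 0 < A /\ qh_bounded_geodesics cX A))) /\
  (forall a : R, 1 <= a -> exists A : R, 0 < A /\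
     forall (X : metricType R) (cX : metric_completion X), minimally_nice X ->
       qh_John cX a -> qh_bounded_geodesics cX A) /\
  (forall A : R, 0 < A -> exists a : R, 1 <= a /\
     forall (X : metricType R) (cX : metric_completion X), minimally_nice X ->
       qh_bounded_geodesics cX A -> qh_John cX a).
Proof.
(* Both implications are first proved with explicit constants that do not involve [X]; these give
   the equivalence and the uniform statements alike. *)
have John_bounded (a : R) (X : metricType R) (cX : metric_completion X) :
    1 <= a -> minimally_nice X -> qh_John cX a ->
    qh_bounded_geodesics cX (10 * a ^+ 2).
  move=> a1 niceX Ja x y L g gg gr.
  exact: (cone_arc_qh_length niceX a1 gg (Ja _ _ _ _ gg) gr).
have bounded_John (A : R) (X : metricType R) (cX : metric_completion X) :
    0 < A -> minimally_nice X -> qh_bounded_geodesics cX A ->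
    qh_John cX (1 + 4 * A * 2 ^+ (Num.truncn (2 * A)).+1).
  by move=> A0 niceX bA; apply: bounded_qh_John => //; exact/ltW/truncnS_gt.
have a_gt0 (a : R) : 1 <= a -> 0 < 10 * a ^+ 2.
  by move=> a1; rewrite mulr_gt0// exprn_gt0// (lt_le_trans ltr01).
have A_ge1 (A : R) : 0 < A -> 1 <= 1 + 4 * A * 2 ^+ (Num.truncn (2 * A)).+1.
  by move=> A0; rewrite lerDl mulr_ge0// mulr_ge0// ltW.
split; [move=> X cX niceX; split|split].
- by move=> [a [a1 Ja]]; exists (10 * a ^+ 2); split; [exact: a_gt0|exact: John_bounded].
- by move=> [A [A0 bA]]; eexists; split; [exact: A_ge1 A0|exact: bounded_John].
- by move=> a a1; exists (10 * a ^+ 2); split; [exact: a_gt0|move=> X cX; exact: John_bounded].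
- by move=> A A0; eexists; split; [exact: A_ge1 A0|move=> X cX; exact: bounded_John].
Qed.
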